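(* Let $d\ge 1$, and let the two-phase Muskat problem, the one-phase Muskat problem and the Dirichlet-Neumann operators $G^\pm(\eta)$ be as defined in the context, with $\mu^->0,\rho^->0$ (and $\mu^+>0,\rho^+>0$ in the two-phase case), $\mathfrak{s}\ge 0$, and $H(\eta)=-\operatorname{div}\big(\nabla\eta/\sqrt{1+|\nabla\eta|^2}\big)$. (i) If $(u,p,\eta)$ solves the one-phase Muskat problem, then $\eta$ (a function of $t$ and $x\in\mathbb{R}^d$) obeys the equation $$\partial_t\eta=-\frac{1}{\mu^-}G^-(\eta)\big(\mathfrak{s}H(\eta)+\rho^-\mathfrak{g}\,\eta\big).\qquad ( * )$$ Conversely, if $\eta$ is a solution of $( * )$, then the one-phase Muskat problem has a solution which admits $\eta$ as the free surface. (ii) If $(u^\pm,p^\pm,\eta)$ is a solution of the two-phase Muskat problem, then $$\partial_t\eta=-\frac{1}{\mu^-}G^-(\eta)f^-,\qquad ( ** )$$ where $f^\pm:=p^\pm|_{\Sigma}+\rho^\pm\mathfrak{g}\,\eta$ satisfy $$\begin{cases} f^--f^+=\mathfrak{s}H(\eta)+(\rho^--\rho^+)\mathfrak{g}\,\eta,\\ \frac{1}{\mu^+}G^+(\eta)f^+-\frac{1}{\mu^-}G^-(\eta)f^-=0.\end{cases}\qquad ( *** )$$ Conversely, if $\eta$ is a solution of $( ** )$ where $f^\pm$ solve $( *** )$, then the two-phase Muskat problem has a solution which admits $\eta$ as the free interface.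
   Context: Geometry. $x\in\mathbb{R}^d$ is the horizontal and $y\in\mathbb{R}$ the vertical variable. The interface is $\Sigma_t=\{(x,\eta(t,x)):x\in\mathbb{R}^d\}$. The rigid boundaries are $\Gamma^\pm=\{(x,b^\pm(x)):x\in\mathbb{R}^d\}$, and the fluid domains are $\Omega^+_t=\{(x,y):\eta(t,x)<y<b^+(x)\}$ and $\Omega^-_t=\{(x,y): b^-(x)<y<\eta(t,x)\}$. Either of $\Gamma^\pm$ may be empty (infinite depth: $b^+=+\infty$, resp. $b^-=-\infty$). The upward unit normal to $\Sigma_t$ is $n=\frac{1}{\sqrt{1+|\nabla\eta|^2}}(-\nabla\eta,1)$, and the outward unit normal to $\Gamma^\pm$ is $\nu^\pm=\pm\frac{1}{\sqrt{1+|\nabla b^\pm|^2}}(-\nabla b^\pm,1)$. The constant $\mathfrak{g}$ is the gravitational acceleration, $\vec e_{d+1}$ is the upward vertical unit vector, $\mu^\pm$ are the viscosities, $\rho^\pm$ the densities and $\mathfrak{s}$ the surface tension coefficient. Two-phase Muskat problem. Unknowns $(u^\pm,p^\pm,\eta)$ satisfying: (1) $\mu^\pm u^\pm+\nabla_{x,y}p^\pm=-\rho^\pm\mathfrak{g}\,\vec e_{d+1}$ and $\operatorname{div}_{x,y}u^\pm=0$ in $\Omega^\pm_t$; (2) $u^+\cdot n=u^-\cdot n$ on $\Sigma_t$; (3) $\partial_t\eta=\sqrt{1+|\nabla\eta|^2}\,u^-\cdot n|_{\Sigma_t}$; (4) $p^--p^+=\mathfrak{s}H(\eta)$ on $\Sigma_t$;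 (5) $u^\pm\cdot\nu^\pm=0$ on $\Gamma^\pm$; if $\Gamma^+$ (resp. $\Gamma^-$) is empty, this is replaced by the condition that $u^+$ (resp. $u^-$) vanishes at infinity. One-phase Muskat problem. This is the case $\mu^+=\rho^+=0$ (the top phase is vacuum): unknowns $(u^-,p^-,\eta)$, written $(u,p,\eta)$, satisfying (1), (3), (5) for the lower fluid only, and (4) replaced by $p^-=\mathfrak{s}H(\eta)$ on $\Sigma_t$. Dirichlet-Neumann operators. With time frozen, for a function $f$ on $\mathbb{R}^d$ (viewed as a function on $\Sigma$ via $x\mapsto(x,\eta(x))$) let $\phi^\pm$ solve $\Delta_{x,y}\phi^\pm=0$ in $\Omega^\pm$, $\phi^\pm=f$ on $\Sigma$, $\partial\phi^\pm/\partial\nu^\pm=0$ on $\Gamma^\pm$ (if $\Gamma^\pm=\emptyset$, the last condition is replaced by $\nabla_{x,y}\phi^\pm\to0$ as $y\to\pm\infty$). Then $G^\pm(\eta)f:=\sqrt{1+|\nabla\eta|^2}\,\frac{\partial\phi^\pm}{\partial n}\big|_\Sigma$, with the upward normal $n$ in both cases. Regularity convention. All functions are assumed regular enough that the equations, traces and normal derivatives make sense, and $\phi^\pm$ as well as $q^\pm=p^\pm+\rho^\pm\mathfrak{g}\,y$ are understood to be finite-energy ($\nabla_{x,y}\in L^2$) solutions, for which the elliptic boundary value problem $\Delta_{x,y}\phi^\pm=0$ in $\Omega^\pm$, $\phi^\pm=f$ on $\Sigma$, $\partial\phi^\pm/\partial\nu^\pm=0$ on $\Gamma^\pm$ (with the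 last condition replaced by $\nabla_{x,y}\phi^\pm\to0$ as $y\to\pm\infty$ if $\Gamma^\pm=\emptyset$) is uniquely solvable. *)

(* Defs.v *)
From HB Require Import structures.
From mathcomp Require Import all_boot all_order all_algebra.
From mathcomp Require Import all_classical all_reals all_analysis.

Set Implicit Arguments.
Unset Strict Implicit.
Unset Printing Implicit Defensive.

Import Order.TTheory GRing.Theory Num.Theory.
Import numFieldNormedType.Exports.

Local Open Scope classical_set_scope.
Local Open Scope ring_scope.

(* A point of R^d x R is a pair (x, y), with x horizontal and y vertical.  The
   library norm on these types is the sup norm; Euclidean lengths are written
   with [dot] or as explicit sums of squares. *)
Notation ambient R d := ('rV[R]_d * R)%type.

(* In finite dimension, differentiability together with continuity of every
   directional derivative is the usual notion of C^1. *)
Definition C1_on (R : realType) (V W : normedModType R) (A : set V)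
    (f : V -> W) : Prop :=
  forall X, A X ->
    differentiable f X /\ forall v, {for X, continuous (fun Y => 'D_v f Y)}.

Definition C2_on (R : realType) (V W : normedModType R) (A : set V)
    (f : V -> W) : Prop :=
  C1_on A f /\ forall v, C1_on A (fun Y => 'D_v f Y).

(* [has_trace Om F]: F, restricted to Om, extends continuously to the closure
   of Om; the values of F outside Om are irrelevant. *)
Definition has_trace (R : realType) (V W : normedModType R) (Om : set V)
    (F : V -> W) : Prop :=
  forall X, closure Om X -> cvg (F Y @[Y --> within Om (nbhs X)]).

Definition trace (R : realType) (V W : normedModType R) (Om : set V)
    (F : V -> W) (X : V) : W :=
  lim (F Y @[Y --> within Om (nbhs X)]).

Definition pd (R : realType) (d : nat) (f : 'rV[R]_d -> R) (i : 'I_d)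
    (x : 'rV[R]_d) : R :=
  'D_(delta_mx 0 i) f x.

Definition hgrad (R : realType) (d : nat) (f : 'rV[R]_d -> R)
    (x : 'rV[R]_d) : 'rV[R]_d :=
  \row_(i < d) pd f i x.

Definition area (R : realType) (d : nat) (f : 'rV[R]_d -> R)
    (x : 'rV[R]_d) : R :=
  Num.sqrt (1 + \sum_(i < d) pd f i x ^+ 2).

Definition curvature (R : realType) (d : nat) (f : 'rV[R]_d -> R)
    (x : 'rV[R]_d) : R :=
  - \sum_(i < d) pd (fun z => pd f i z / area f z) i x.

Definition dot (R : realType) (d : nat) (u v : ambient R d) : R :=
  \sum_(i < d) u.1 0 i * v.1 0 i + u.2 * v.2.

Definition ehor (R : realType) (d : nat) (i : 'I_d) : ambient R d :=
  (delta_mx 0 i, 0).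

Definition ever (R : realType) (d : nat) : ambient R d := (0, 1).

Definition grad (R : realType) (d : nat) (f : ambient R d -> R)
    (X : ambient R d) : ambient R d :=
  (\row_(i < d) 'D_(@ehor R d i) f X, 'D_(@ever R d) f X).

Definition div (R : realType) (d : nat) (F : ambient R d -> ambient R d)
    (X : ambient R d) : R :=
  \sum_(i < d) 'D_(@ehor R d i) (fun Y => (F Y).1 0 i) X +
  'D_(@ever R d) (fun Y => (F Y).2) X.

Definition laplacian (R : realType) (d : nat) (f : ambient R d -> R)
    (X : ambient R d) : R :=
  div (grad f) X.

(* Integral of a nonnegative Borel function over R^n, as an iterated
   one-dimensional Lebesgue integral (Tonelli). *)
Fixpoint integral_rV (R : realType) (n : nat) : ('rV[R]_n -> \bar R) -> \bar R :=
  match n with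
  | 0%N => fun F => F 0
  | m.+1 => fun F =>
      (\int[@lebesgue_measure R]_s
         integral_rV (fun v : 'rV[R]_m => F (row_mx (s%:M : 'rV[R]_1) v)))%E
  end.

Definition finite_energy (R : realType) (d : nat) (Om : set (ambient R d))
    (F : ambient R d -> ambient R d) : Prop :=
  (integral_rV (fun x : 'rV[R]_d =>
     \int[@lebesgue_measure R]_(y in [set y | Om (x, y)])
       (dot (F (x, y)) (F (x, y)))%:E) < +oo)%E.

Inductive phase := upper | lower.

Definition psign (R : realType) (s : phase) : R :=
  if s is upper then 1 else -1.
Arguments psign R s : clear implicits.

(* A rigid boundary is [Some b], the graph of b, or [None] when it is empty
   (infinite depth). *)
Definition wall (R : realType) (d : nat) : Type := option ('rV[R]_d -> R).

Definition fluid (R : realType) (d : nat) (s : phase) (w : wall R d)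
    (eta : 'rV[R]_d -> R) : set (ambient R d) :=
  match s with
  | upper => [set X | eta X.1 < X.2 /\ if w is Some b then X.2 < b X.1 else True]
  | lower => [set X | X.2 < eta X.1 /\ if w is Some b then b X.1 < X.2 else True]
  end.

Definition wall_ok (R : realType) (d : nat) (s : phase) (w : wall R d)
    (eta : 'rV[R]_d -> R) : Prop :=
  if w is Some b then
    (forall x, differentiable b x) /\
    (forall x, if s is upper then eta x < b x else b x < eta x)
  else True.

Definition normal (R : realType) (d : nat) (f : 'rV[R]_d -> R)
    (x : 'rV[R]_d) : ambient R d :=
  (area f x)^-1 *: ((- hgrad f x, 1) : ambient R d).

Definition wall_normal (R : realType) (d : nat) (s : phase) (b : 'rV[R]_d -> R)
    (x : 'rV[R]_d) : ambient R d :=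
  psign R s *: normal b x.

Definition on_interface (R : realType) (d : nat) (W : normedModType R)
    (s : phase) (w : wall R d) (eta : 'rV[R]_d -> R) (F : ambient R d -> W)
    (x : 'rV[R]_d) : W :=
  trace (fluid s w eta) F (x, eta x).

(* No flux through the wall; without a wall, F -> 0 as y -> +oo (upper phase)
   or y -> -oo (lower phase), uniformly in x. *)
Definition wall_condition (R : realType) (d : nat) (s : phase) (w : wall R d)
    (eta : 'rV[R]_d -> R) (F : ambient R d -> ambient R d) : Prop :=
  match w with
  | Some b => forall x,
      dot (trace (fluid s w eta) F (x, b x)) (wall_normal s b x) = 0
  | None => forall e : R, 0 < e -> exists M : R, forall X,
      fluid s w eta X -> M < psign R s * X.2 -> `|F X| < e
  end.

Record elliptic_solution (R : realType) (d : nat) (s : phase) (w : wall R d)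
    (eta f : 'rV[R]_d -> R) (phi : ambient R d -> R) : Prop := EllipticSolution {
  ell_C2 : C2_on (fluid s w eta) phi ;
  ell_trace : has_trace (fluid s w eta) phi ;
  ell_grad_trace : has_trace (fluid s w eta) (grad phi) ;
  ell_energy : finite_energy (fluid s w eta) (grad phi) ;
  ell_harmonic : forall X, fluid s w eta X -> laplacian phi X = 0 ;
  ell_dirichlet : forall x, on_interface s w eta phi x = f x ;
  ell_wall : wall_condition s w eta (grad phi)
}.

Definition elliptic_unique (R : realType) (d : nat) (s : phase) (w : wall R d)
    (eta : 'rV[R]_d -> R) : Prop :=
  forall f phi psi,
    elliptic_solution s w eta f phi -> elliptic_solution s w eta f psi ->
    forall X, fluid s w eta X -> phi X = psi X.

Definition DN_dom (R : realType) (d : nat) (s : phase) (w : wall R d)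
    (eta f : 'rV[R]_d -> R) : Prop :=
  exists phi, elliptic_solution s w eta f phi.

Definition harmonic_ext (R : realType) (d : nat) (s : phase) (w : wall R d)
    (eta f : 'rV[R]_d -> R) : ambient R d -> R :=
  xget (fun=> 0) [set phi | elliptic_solution s w eta f phi].

(* Dirichlet-Neumann operator, with the upward normal for both phases.  It is
   well defined for f in [DN_dom s w eta] when [elliptic_unique s w eta]. *)
Definition DN (R : realType) (d : nat) (s : phase) (w : wall R d)
    (eta f : 'rV[R]_d -> R) (x : 'rV[R]_d) : R :=
  area eta x *
  dot (on_interface s w eta (grad (harmonic_ext s w eta f)) x) (normal eta x).

Definition regular_interface (R : realType) (d : nat) (T : set R)
    (eta : R -> 'rV[R]_d -> R) : Prop :=
  forall t, T t ->
    C2_on setT (eta t) /\ forall x, derivable (fun r => eta r x) t 1.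

Definition dt (R : realType) (d : nat) (eta : R -> 'rV[R]_d -> R) (t : R)
    (x : 'rV[R]_d) : R :=
  derive1 (fun r => eta r x) t.

Record darcy (R : realType) (d : nat) (s : phase) (w : wall R d)
    (g mu rho : R) (eta : 'rV[R]_d -> R)
    (u : ambient R d -> ambient R d) (p : ambient R d -> R) : Prop := Darcy {
  darcy_u_C1 : C1_on (fluid s w eta) u ;
  darcy_p_C1 : C1_on (fluid s w eta) p ;
  darcy_u_trace : has_trace (fluid s w eta) u ;
  darcy_p_trace : has_trace (fluid s w eta) p ;
  darcy_energy :
    finite_energy (fluid s w eta) (grad (fun X => p X + rho * g * X.2)) ;
  darcy_law : forall X, fluid s w eta X ->
    mu *: u X + grad p X = - (rho * g) *: @ever R d ;
  darcy_div : forall X, fluid s w eta X -> div u X = 0 ;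
  darcy_wall : wall_condition s w eta u
}.

Definition kinematic (R : realType) (d : nat) (w : wall R d)
    (eta : R -> 'rV[R]_d -> R) (u : ambient R d -> ambient R d) (t : R) : Prop :=
  forall x, dt eta t x =
    area (eta t) x * dot (on_interface lower w (eta t) u x) (normal (eta t) x).

Definition one_phase_muskat (R : realType) (d : nat) (T : set R) (w : wall R d)
    (g sigma mu rho : R) (u : R -> ambient R d -> ambient R d)
    (p : R -> ambient R d -> R) (eta : R -> 'rV[R]_d -> R) : Prop :=
  forall t, T t ->
    [/\ darcy lower w g mu rho (eta t) (u t) (p t),
        kinematic w eta (u t) t
      & forall x, on_interface lower w (eta t) (p t) x =
          sigma * curvature (eta t) x].

Definition two_phase_muskat (R : realType) (d : nat) (T : set R)
    (wp wm : wall R d) (g sigma mup mum rhop rhom : R)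
    (up um : R -> ambient R d -> ambient R d) (pp pm : R -> ambient R d -> R)
    (eta : R -> 'rV[R]_d -> R) : Prop :=
  forall t, T t ->
    [/\ darcy upper wp g mup rhop (eta t) (up t) (pp t),
        darcy lower wm g mum rhom (eta t) (um t) (pm t),
        forall x, dot (on_interface upper wp (eta t) (up t) x) (normal (eta t) x)
          = dot (on_interface lower wm (eta t) (um t) x) (normal (eta t) x),
        kinematic wm eta (um t) t
      & forall x, on_interface lower wm (eta t) (pm t) x
          - on_interface upper wp (eta t) (pp t) x = sigma * curvature (eta t) x].

(* d_t eta = - (1/mu) G^-(eta) f, including that G^-(eta) f is defined *)
Definition evolution_eq (R : realType) (d : nat) (T : set R) (w : wall R d)
    (mu : R) (eta f : R -> 'rV[R]_d -> R) : Prop :=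
  forall t, T t ->
    DN_dom lower w (eta t) (f t) /\
    forall x, dt eta t x = - mu^-1 * DN lower w (eta t) (f t) x.

Definition interface_system (R : realType) (d : nat) (T : set R)
    (wp wm : wall R d) (g sigma mup mum rhop rhom : R)
    (eta fp fm : R -> 'rV[R]_d -> R) : Prop :=
  forall t, T t ->
    [/\ DN_dom upper wp (eta t) (fp t),
        DN_dom lower wm (eta t) (fm t),
        forall x, fm t x - fp t x =
          sigma * curvature (eta t) x + (rhom - rhop) * g * eta t x
      & forall x, mup^-1 * DN upper wp (eta t) (fp t) x
          - mum^-1 * DN lower wm (eta t) (fm t) x = 0].

(* Main.v *)
(** In terms of the reduced pressure [q = p + rho g y], Darcy's law reads
    [mu u = - grad q] and incompressibility says that [q] is harmonic; the wall
    condition on [u] is the Neumann condition on [q].  Hence Darcy flows in a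
    fluid domain correspond to solutions of the elliptic problem defining the
    Dirichlet-Neumann operator, with Dirichlet datum the interface value of [q]
    and with normal velocity at the interface [- 1/mu] times the operator.  The
    kinematic, continuity and pressure-jump conditions then translate one by
    one.  Since the operator is defined through an arbitrary chosen solution,
    uniqueness is used to compute it from [q]; conversely, a flow is built from
    the chosen solution itself. *)

From HB Require Import structures.
Require Import Defs.
From mathcomp Require Import all_boot all_order all_algebra.
From mathcomp Require Import all_classical all_reals all_analysis.
From mathcomp Require Import ring.

Set Implicit Arguments.
Unset Strict Implicit.
Unset Printing Implicit Defensive.

Import Order.TTheory GRing.Theory Num.Theory.
Import numFieldNormedType.Exports.

Local Open Scope classical_set_scope.
Local Open Scope ring_scope.

(** * Maps of class C^1 on an open set: locality and closure properties *)

Lemma near_eq_differentiable (R : realType) (V W : normedModType R)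
    (f g : V -> W) (X : V) :
  (\near X, f X = g X) -> differentiable f X -> differentiable g X.
Proof.
move=> fg df.
have fgX : f X = g X by exact: nbhs_singleton fg.
have /diff_locallyP [dfc /eqaddoP dfo] := df.
(* The candidate differential of [g] is that of [f]: near [X] the two remainders coincide, and
   [diff_unique] then identifies ['d g X] with ['d f X]. *)
have gX : g \o shift X = cst (g X) + 'd f X +o_ 0 id.
  apply/eqaddoP => e e0; have := dfo e e0.
  have fg0 : \forall h \near (0 : V), f (h + X) = g (h + X).
    by move: fg; rewrite (near_shift 0 X) subr0.
  apply: filterS2 fg0 => h fgh.
  by rewrite !fctE /= fgX fgh.
by apply/diff_locallyP; rewrite (diff_unique dfc gX).
Qed.

Section C1.
Context {R : realType} {V : normedModType R} {A : set V}.
Hypothesis openA : open A.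

Lemma derive_eq_on (W : normedModType R) (f g : V -> W) (v X : V) :
  (forall Y, A Y -> f Y = g Y) -> A X -> 'D_v f X = 'D_v g X.
Proof.
move=> fg AX; apply: near_eq_derive.
by apply: filterS fg _; exact: open_nbhs_nbhs.
Qed.

Lemma C1_on_eq (W : normedModType R) (f g : V -> W) :
  (forall Y, A Y -> f Y = g Y) -> C1_on A f -> C1_on A g.
Proof.
move=> fg Cf X AX; have [df cf] := Cf X AX.
have nA : nbhs X A by exact: open_nbhs_nbhs.
split=> [|v].
  by apply: near_eq_differentiable df; apply: filterS fg nA.
rewrite /prop_for /continuous_at -(derive_eq_on _ fg AX).
apply: cvg_trans (cf v); apply: near_eq_cvg.
by apply: filterS nA => Y AY; exact: derive_eq_on.
Qed.

Lemma derive_linear_comp (W Z : normedModType R) (L : {linear W -> Z})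
    (f : V -> W) (v X : V) :
  continuous L -> differentiable f X ->
  'D_v (fun Y => L (f Y)) X = L ('D_v f X).
Proof.
move=> cL df; have dL : differentiable L (f X) by exact: linear_differentiable.
rewrite (deriveE _ (differentiable_comp df dL)) diff_comp//.
by rewrite /= diff_lin// deriveE.
Qed.

Lemma C1_on_linear (W Z : normedModType R) (L : {linear W -> Z}) (f : V -> W) :
  continuous L -> C1_on A f -> C1_on A (fun Y => L (f Y)).
Proof.
move=> cL Cf X AX; have [df cf] := Cf X AX; split=> [|v].
  by apply: (differentiable_comp df); exact: linear_differentiable.
rewrite /prop_for /continuous_at derive_linear_comp//.
have -> : L ('D_v f X) = (L \o (fun Y => 'D_v f Y)) X by [].
apply: cvg_trans (continuous_comp (cf v) (cL _)); apply: near_eq_cvg.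
apply: filterS (open_nbhs_nbhs (conj openA AX)) => Y AY /=.
by rewrite derive_linear_comp//; case: (Cf Y AY).
Qed.

Lemma C1_onD (W : normedModType R) (f g : V -> W) :
  C1_on A f -> C1_on A g -> C1_on A (fun Y => f Y + g Y).
Proof.
move=> Cf Cg X AX; have [df cf] := Cf X AX; have [dg cg] := Cg X AX.
(* Continuity of the derivative at [X] needs this identity at all points near [X], hence on the
   whole open set [A]. *)
have DD v Y : A Y ->
    'D_v f Y + 'D_v g Y = 'D_v (fun Y => f Y + g Y) Y.
  move=> AY; have [dfY _] := Cf Y AY; have [dgY _] := Cg Y AY.
  by rewrite -deriveD//; exact: diff_derivable.
split=> [|v]; first exact: differentiableD.
rewrite /prop_for /continuous_at -DD//.
apply: cvg_trans (cvgD (cf v) (cg v)); apply: near_eq_cvg.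
apply: filterS (open_nbhs_nbhs (conj openA AX)) => Y AY /=.
by rewrite -DD.
Qed.

Lemma C1_on_cst (W : normedModType R) (c : W) : C1_on A (fun=> c).
Proof.
move=> X AX; split=> [|v]; first exact: differentiable_cst.
have -> : (fun Y => 'D_v (fun=> c) Y) = fun=> 0.
  by apply/funext => Y; exact: derive_cst.
exact: cst_continuous.
Qed.

Lemma C1_on_sum (W : normedModType R) (I : Type) (r : seq I) (F : I -> V -> W) :
  (forall i, C1_on A (F i)) -> C1_on A (fun Y => \sum_(i <- r) F i Y).
Proof.
move=> CF; elim: r => [|i r IH].
  by under eq_fun do rewrite big_nil; exact: C1_on_cst.
by under eq_fun do rewrite big_cons; exact: C1_onD.
Qed.

Lemma linear_C1_on (W : normedModType R) (L : {linear V -> W}) :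
  continuous L -> C1_on A L.
Proof.
move=> cL X AX; split=> [|v]; first exact: linear_differentiable.
have -> : (fun Y => 'D_v L Y) = fun=> L v.
  apply/funext => Y; rewrite deriveE ?diff_lin//.
  exact: linear_differentiable.
exact: cst_continuous.
Qed.

End C1.

(** * Traces as limits taken from inside a set *)

Section Trace.
Context {R : realType} {V : normedModType R} (Om : set V).

(** The filter [within Om] ignores values outside [Om]. Equality of the image filters themselves
    transports both [cvg] and [lim], so traces can be compared without first knowing that they
    exist. *)
Lemma fmap_within_eq (W : normedModType R) (F G : V -> W) (X : V) :
  (forall Y, Om Y -> F Y = G Y) ->
  F Y @[Y --> within Om (nbhs X)] = G Y @[Y --> within Om (nbhs X)].
Proof.
move=> FG; apply/funext => B; apply/propext.
by split; apply: (@filterS _ (nbhs X)) => Y OB OY;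
  move: (OB OY); rewrite /preimage /= FG.
Qed.

Lemma has_trace_eq (W : normedModType R) (F G : V -> W) :
  (forall Y, Om Y -> F Y = G Y) -> has_trace Om F -> has_trace Om G.
Proof. by move=> FG HF X cX; rewrite -(fmap_within_eq X FG); exact: HF. Qed.

Lemma trace_eq (W : normedModType R) (F G : V -> W) (X : V) :
  (forall Y, Om Y -> F Y = G Y) -> trace Om F X = trace Om G X.
Proof. by move=> FG; rewrite /trace (fmap_within_eq X FG). Qed.

(** Membership in the closure makes the filter [within Om (nbhs X)] proper, and limits along a
    proper filter are unique. *)
Lemma trace_unique (W : normedModType R) (F : V -> W) (X : V) (l : W) :
  closure Om X -> F Y @[Y --> within Om (nbhs X)] --> l -> trace Om F X = l.
Proof.
by move=> cX; have := within_nbhs_proper cX => PF; exact: cvg_lim.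
Qed.

Lemma has_trace_continuous (W : normedModType R) (F : V -> W) :
  continuous F -> has_trace Om F.
Proof.
move=> cF X _; apply/cvg_ex; exists (F X).
by apply: cvg_trans (cF X); apply: cvg_app; exact: cvg_within.
Qed.

Lemma trace_continuous (W : normedModType R) (F : V -> W) (X : V) :
  closure Om X -> continuous F -> trace Om F X = F X.
Proof.
move=> cX cF; apply: trace_unique => //.
by apply: cvg_trans (cF X); apply: cvg_app; exact: cvg_within.
Qed.

Lemma has_traceD (W : normedModType R) (F G : V -> W) :
  has_trace Om F -> has_trace Om G -> has_trace Om (fun Y => F Y + G Y).
Proof. by move=> HF HG X cX; apply: is_cvgD; [exact: HF|exact: HG]. Qed.

Lemma traceD (W : normedModType R) (F G : V -> W) (X : V) :
  has_trace Om F -> has_trace Om G -> closure Om X ->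
  trace Om (fun Y => F Y + G Y) X = trace Om F X + trace Om G X.
Proof.
move=> HF HG cX; apply: trace_unique => //.
by apply: cvgD; [exact: HF|exact: HG].
Qed.

Lemma has_traceZ (W : normedModType R) (c : R) (F : V -> W) :
  has_trace Om F -> has_trace Om (fun Y => c *: F Y).
Proof. by move=> HF X cX; apply: is_cvgZl_tmp; exact: HF. Qed.

Lemma traceZ (W : normedModType R) (c : R) (F : V -> W) (X : V) :
  has_trace Om F -> closure Om X ->
  trace Om (fun Y => c *: F Y) X = c *: trace Om F X.
Proof.
move=> HF cX; apply: trace_unique => //.
by apply: cvgZl_tmp; exact: HF.
Qed.

End Trace.

(** * Topology of the fluid domains: openness and boundary points *)

Lemma open_lt_fun (R : realType) (V : topologicalType) (h k : V -> R) :
  continuous h -> continuous k -> open [set X | h X < k X].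
Proof.
move=> ch ck.
have -> : [set X | h X < k X] = (fun X => k X - h X) @^-1` [set r | 0 < r].
  by apply/seteqP; split=> X /=; rewrite subr_gt0.
apply: open_comp; last exact: open_gt.
by move=> X _; apply: cvgB; [exact: ck|exact: ch].
Qed.

(** Each end of an open vertical segment is approached along the segment itself. *)
Lemma closure_segment (R : realType) (V : normedModType R) (Om : set (V * R))
    (x : V) (a b : R) :
  a < b -> (forall y, a < y < b -> Om (x, y)) ->
  closure Om (x, a) /\ closure Om (x, b).
Proof.
move=> ab OmI.
(* Both ends are treated at once: [c] is the end and [s], equal to 1 or -1, the direction from it
   into the segment. *)
have near_end c (s : R) : `|s| = 1 ->
    (forall r, 0 < r < b - a -> a < c + s * r < b) -> closure Om (x, c).
  move=> s1 cI B [[P Q] [/= nP nQ] PQB].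
  have /nbhs_ballP[e /= e0 eQ] := nQ.
  (* Half the minimum is strictly less than both [e] and [b - a], so the shifted point stays in the
     ball and inside the segment. *)
  pose r := Num.min e (b - a) / 2.
  have m0 : 0 < Num.min e (b - a) by rewrite lt_min e0 subr_gt0.
  have r0 : 0 < r by rewrite divr_gt0.
  have rm : r < Num.min e (b - a) by rewrite ltr_pdivrMr// mulrDr mulr1 ltrDl.
  have /andP[re rb] : (r < e) && (r < b - a) by rewrite -lt_min.
  exists (x, c + s * r); split; first by apply: OmI; rewrite cI// r0.
  apply: PQB; split=> /=; first exact: nbhs_singleton.
  apply: eQ; rewrite -ball_normE /= opprD addNKr normrN normrM s1 mul1r.
  by rewrite gtr0_norm.
split.
  apply: (near_end a 1); rewrite ?normr1// => r /andP[r0 rb].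
  by rewrite mul1r ltrDl r0 -ltrBrDl.
apply: (near_end b (-1)); rewrite ?normrN1// => r /andP[r0 rb].
by rewrite mulN1r gtrBl r0 ltrBrDl -ltrBrDr rb.
Qed.

Section Fluid.
Context {R : realType} {d : nat}.
Implicit Types (s : phase) (w : wall R d) (eta b : 'rV[R]_d -> R).

Lemma open_fluid s w eta :
  continuous eta -> wall_ok s w eta -> open (fluid s w eta).
Proof.
move=> ceta wok.
have c1 b : continuous b -> continuous (fun X : ambient R d => b X.1).
  by move=> cb X; apply: (continuous_comp (@cvg_fst _ _ _ _ _)); exact: cb.
have c2 : continuous (fun X : ambient R d => X.2) by move=> X; exact: cvg_snd.
have cb b : w = Some b -> continuous b.
  move=> wb x; apply: differentiable_continuous.
  by move: wok; rewrite wb => -[].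
case: w cb {wok} => [b /(_ _ erefl) cb|_]; case: s => /=.
- by apply: openI; apply: open_lt_fun => //; exact: c1.
- by apply: openI; apply: open_lt_fun => //; exact: c1.
- rewrite [X in open X](_ : _ = [set X | eta X.1 < X.2]).
    by apply: open_lt_fun => //; exact: c1.
  by apply/seteqP; split=> X /=; [case|].
- rewrite [X in open X](_ : _ = [set X | X.2 < eta X.1]).
    by apply: open_lt_fun => //; exact: c1.
  by apply/seteqP; split=> X /=; [case|].
Qed.

(** The vertical segment from the interface to the wall lies in the fluid. Without a wall, a segment
    of length 1 does; the length is arbitrary. *)
Lemma closure_interface s w eta x :
  wall_ok s w eta -> closure (fluid s w eta) (x, eta x).
Proof.
case: s w => -[b [_ /(_ x) eb]|_].
- have [|y /andP[]|] := @closure_segment _ _ (fluid upper (Some b) eta) x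
    (eta x) (b x); by [].
- have [|y /andP[]|] := @closure_segment _ _ (fluid upper None eta) x
    (eta x) (eta x + 1); by rewrite ?ltrDl.
- have [|y /andP[]|_] := @closure_segment _ _ (fluid lower (Some b) eta) x
    (b x) (eta x); by [].
- have [|y /andP[]|_] := @closure_segment _ _ (fluid lower None eta) x
    (eta x - 1) (eta x); by rewrite ?gtrBl.
Qed.

Lemma closure_wall s b eta x :
  wall_ok s (Some b) eta -> closure (fluid s (Some b) eta) (x, b x).
Proof.
case: s => -[_ /(_ x) eb].
- have [|y /andP[]|_] := @closure_segment _ _ (fluid upper (Some b) eta) x
    (eta x) (b x); by [].
- have [|y /andP[]|] := @closure_segment _ _ (fluid lower (Some b) eta) x
    (b x) (eta x); by [].
Qed.

(** * Euclidean pairing, gradient and divergence on the ambient space *)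

Lemma area_gt0 eta x : 0 < area eta x.
Proof.
rewrite sqrtr_gt0 ltr_pwDl//.
by apply: sumr_ge0 => i _; exact: sqr_ge0.
Qed.

Lemma dot_is_linear (u : ambient R d) : linear (dot u : _ -> R^o).
Proof.
move=> a v w; rewrite /dot /= scalerDr scaler_sumr addrACA -big_split /=.
congr (_ + _).
  by apply: eq_bigr => i _; rewrite !mxE mulrDr mulrCA.
by rewrite mulrDr mulrCA.
Qed.

HB.instance Definition _ (u : ambient R d) :=
  GRing.isLinear.Build R (ambient R d) R *:%R (dot u) (@dot_is_linear u).

Lemma continuous_dot (u : ambient R d) : continuous (dot u : ambient R d -> R).
Proof.
move=> X; apply: cvgD; last by apply: cvgM; [exact: cvg_cst|exact: cvg_snd].
apply: cvg_big => [|i _].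
  exact: add_continuous.
apply: cvgM; first exact: cvg_cst.
apply: (@continuous_comp _ _ _ (@fst 'rV[R]_d R) (fun x => x 0 i) X).
  exact: cvg_fst.
exact: coord_continuous.
Qed.

Lemma dotC (u v : ambient R d) : dot u v = dot v u.
Proof.
by rewrite /dot mulrC; congr (_ + _); apply: eq_bigr => i _; rewrite mulrC.
Qed.

Lemma dotZl (c : R) (u v : ambient R d) : dot (c *: u) v = c * dot u v.
Proof. by rewrite dotC linearZ dotC. Qed.

Lemma dot_ehor (i : 'I_d) (v : ambient R d) : dot (@ehor R d i) v = v.1 0 i.
Proof.
rewrite /dot /= mul0r addr0 (bigD1 i)//= big1 ?addr0 ?mxE ?eqxx ?mul1r//.
by move=> j ji; rewrite mxE (negbTE ji) andbF mul0r.
Qed.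

Lemma dot_ever (v : ambient R d) : dot (@ever R d) v = v.2.
Proof.
by rewrite /dot /= mul1r big1 ?add0r// => i _; rewrite mxE mul0r.
Qed.

Lemma ambient_sum (v : ambient R d) :
  v = \sum_(i < d) v.1 0 i *: @ehor R d i + v.2 *: @ever R d.
Proof.
case: v => x y /=; congr pair => /=.
  by rewrite (raddf_sum fst) /= scaler0 addr0 [LHS]row_sum_delta.
rewrite (raddf_sum snd) /= big1 ?add0r ?[_ *: _]mulr1// => i _.
exact: scaler0.
Qed.

Lemma derive_grad (f : ambient R d -> R) (v X : ambient R d) :
  differentiable f X -> 'D_v f X = dot v (grad f X).
Proof.
move=> df; rewrite deriveE// [in LHS](ambient_sum v) linearD linear_sum linearZ /=.
rewrite /dot /= deriveE//; congr (_ + _).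
by apply: eq_bigr => i _; rewrite linearZ mxE deriveE.
Qed.

(** [div] differentiates the scalar components of [F]. Each component is the pairing with a basis
    vector, a continuous linear map, and so commutes with differentiation of the vector field. *)
Lemma div_differentiable (F : ambient R d -> ambient R d) (X : ambient R d) :
  differentiable F X ->
  div F X = \sum_(i < d) ('D_(@ehor R d i) F X).1 0 i + ('D_(@ever R d) F X).2.
Proof.
move=> dF.
have cE v e : 'D_v (fun Y => dot e (F Y)) X = dot e ('D_v F X).
  by apply: derive_linear_comp => //; exact: continuous_dot.
rewrite /div; congr (_ + _).
  apply: eq_bigr => i _; rewrite -dot_ehor -cE.
  by under [in RHS]eq_fun do rewrite dot_ehor.
rewrite -dot_ever -cE.
by under [in RHS]eq_fun do rewrite dot_ever.
Qed.

Lemma divZ (c : R) (F : ambient R d -> ambient R d) (X : ambient R d) :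
  differentiable F X -> div (fun Y => c *: F Y) X = c * div F X.
Proof.
move=> dF.
have DZ v : 'D_v (fun Y => c *: F Y) X = c *: 'D_v F X.
  by rewrite -deriveZ//; exact: diff_derivable.
rewrite !div_differentiable//; last exact: differentiableZ.
rewrite mulrDr mulr_sumr !DZ; congr (_ + _).
by apply: eq_bigr => i _; rewrite DZ mxE.
Qed.

Lemma div_eq_on (A : set (ambient R d)) (F G : ambient R d -> ambient R d)
    (X : ambient R d) :
  open A -> (forall Y, A Y -> F Y = G Y) -> A X -> div F X = div G X.
Proof.
move=> oA FG AX; rewrite /div; congr (_ + _).
  by apply: eq_bigr => i _; apply: (derive_eq_on oA) => // Y /FG ->.
by apply: (derive_eq_on oA) => // Y /FG ->.
Qed.

Lemma grad_eq_on (A : set (ambient R d)) (f g : ambient R d -> R)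
    (X : ambient R d) :
  open A -> (forall Y, A Y -> f Y = g Y) -> A X -> grad f X = grad g X.
Proof.
move=> oA fg AX; rewrite /grad; congr pair; last exact: derive_eq_on fg AX.
by apply/rowP => i; rewrite !mxE; exact: derive_eq_on fg AX.
Qed.

(** [C2_on] speaks of scalar directional derivatives only. The gradient is the sum of those along
    the basis vectors, each multiplied by its vector, and [a *: e] is linear and continuous in
    [a]. *)
Lemma C1_on_grad (A : set (ambient R d)) (f : ambient R d -> R) :
  open A -> C2_on A f -> C1_on A (grad f).
Proof.
move=> oA [_ C2].
have Cline v (e : ambient R d) : C1_on A (fun Y => 'D_v f Y *: e).
  have lin_e : linear (fun a : R^o => a *: e).
    by move=> a x y; rewrite scalerDl scalerA.
  pose L : {linear R^o -> ambient R d} := HB.pack (fun a : R^o => a *: e)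
    (GRing.isLinear.Build R R^o (ambient R d) *:%R _ lin_e).
  apply: (C1_on_linear oA (L := L)) (C2 v).
  by move=> a; apply: cvgZr_tmp; exact: cvg_id.
have := C1_onD oA (C1_on_sum oA (index_enum 'I_d)
  (fun i => Cline (@ehor R d i) (@ehor R d i))) (Cline (@ever R d) (@ever R d)).
apply: C1_on_eq => // Y AY.
rewrite [RHS]ambient_sum; congr (_ + _).
by apply: eq_bigr => i _; rewrite mxE.
Qed.

(** Velocity and gradient of the reduced pressure are proportional in the fluid, so this carries the
    wall condition either way between them. At infinite depth the tolerance is divided by [|c|]. *)
Lemma wall_conditionZ s w eta c (F G : ambient R d -> ambient R d) :
  wall_ok s w eta -> c != 0 -> has_trace (fluid s w eta) F ->
  (forall X, fluid s w eta X -> G X = c *: F X) ->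
  wall_condition s w eta F -> wall_condition s w eta G.
Proof.
case: w => [b|] wok c0 HF GF.
  move=> H x; rewrite (trace_eq _ GF) traceZ//; last exact: closure_wall.
  by rewrite dotZl H mulr0.
move=> H e e0.
have c_gt0 : 0 < `|c| by rewrite normr_gt0.
have [|M HM] := H (e / `|c|); first exact: divr_gt0.
exists M => X OX MX; rewrite GF// normrZ mulrC -ltr_pdivlMr//.
exact: HM.
Qed.

End Fluid.

(** * Darcy flows and solutions of the elliptic problem *)

Section Darcy.
Context {R : realType} {d : nat}.

Lemma C1_on_height (A : set (ambient R d)) (c : R) :
  open A -> C1_on A (fun X : ambient R d => c * X.2).
Proof.
(* Written as a pairing, the hydrostatic term is visibly a continuous linear form. *)
move=> oA; have -> : (fun X : ambient R d => c * X.2) = dot (c *: @ever R d).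
  by apply/funext => Y; rewrite dotZl dot_ever.
apply: linear_C1_on; exact: continuous_dot.
Qed.

Lemma continuous_height (c : R) : continuous (fun X : ambient R d => c * X.2).
Proof. by move=> X; apply: cvgM; [exact: cvg_cst|exact: cvg_snd]. Qed.

Lemma grad_height (p : ambient R d -> R) (c : R) (X : ambient R d) :
  differentiable p X ->
  grad (fun Y => p Y + c * Y.2) X = grad p X + c *: @ever R d.
Proof.
move=> dp.
have dl : differentiable (dot (c *: @ever R d) : _ -> R) X.
  by apply: linear_differentiable; exact: continuous_dot.
have D v : 'D_v (fun Y => p Y + c * Y.2) X = 'D_v p X + c * v.2.
  have -> : (fun Y => p Y + c * Y.2) = p + dot (c *: @ever R d).
    by apply/funext => Y; rewrite -dot_ever -dotZl.
  rewrite (deriveD (diff_derivable dp) (diff_derivable dl)).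
  rewrite (deriveE _ dl) diff_lin; last exact: continuous_dot.
  by rewrite -(dot_ever v) -dotZl.
rewrite /grad D; congr pair => /=.
by apply/rowP => i; rewrite !mxE D /= mulr0.
Qed.

Section Phase.
Variables (s : phase) (w : wall R d) (eta : 'rV[R]_d -> R).
Hypotheses (ceta : continuous eta) (wok : wall_ok s w eta).
Let Om := fluid s w eta.

Lemma on_interfaceZ (c : R) (F G : ambient R d -> ambient R d) x :
  has_trace Om F -> (forall X, Om X -> G X = c *: F X) ->
  on_interface s w eta G x = c *: on_interface s w eta F x.
Proof.
move=> HF GF; rewrite /on_interface (trace_eq _ GF) traceZ//.
exact: closure_interface.
Qed.

Lemma on_interface_height (p : ambient R d -> R) (c : R) x :
  has_trace Om p ->
  on_interface s w eta (fun X => p X + c * X.2) x =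
  on_interface s w eta p x + c * eta x.
Proof.
move=> Hp; have ch := @continuous_height c.
have cl : closure Om (x, eta x) by exact: closure_interface.
rewrite /on_interface (traceD Hp (has_trace_continuous ch) cl).
by rewrite (trace_continuous cl ch).
Qed.

Lemma has_trace_height (p : ambient R d -> R) (c : R) :
  has_trace Om p -> has_trace Om (fun X => p X + c * X.2).
Proof.
move=> Hp.
exact: (has_traceD Hp (has_trace_continuous (@continuous_height c))).
Qed.

Lemma darcy_grad (g mu rho : R) u p : darcy s w g mu rho eta u p ->
  forall X, Om X -> grad (fun X => p X + rho * g * X.2) X = - mu *: u X.
Proof.
move=> [_ Cp _ _ _ law _ _] X OX; have [dp _] := Cp X OX.
rewrite grad_height//; apply/eqP; rewrite scaleNr -addr_eq0 addrC addrA.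
by rewrite law// scaleNr addNr.
Qed.

Lemma darcy_elliptic (g mu rho : R) u p :
  mu != 0 -> darcy s w g mu rho eta u p ->
  elliptic_solution s w eta
    (fun x => on_interface s w eta p x + rho * g * eta x)
    (fun X => p X + rho * g * X.2).
Proof.
move=> mu0 D; have gradq := darcy_grad D; case: D => Cu Cp Hu Hp En law divu wc.
have oO : open Om by exact: open_fluid.
have gradq' X : Om X -> - mu *: u X = grad (fun X => p X + rho * g * X.2) X.
  by move=> OX; rewrite gradq.
have Cq : C1_on Om (fun X => p X + rho * g * X.2).
  exact: (C1_onD oO Cp (C1_on_height (rho * g) oO)).
split.
- split=> [|v]; first exact: Cq.
  (* The pressure is only assumed C^1; the second derivatives of [q] come from [u], because the
     derivative of [q] along [v] is the pairing of [- mu *: v] with the C^1 field [u]. *)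
  apply: (@C1_on_eq _ _ _ oO _ (fun X => dot (- mu *: v) (u X))).
    move=> X OX; have [dq _] := Cq X OX.
    by rewrite derive_grad// gradq// dotZl linearZ.
  exact: (@C1_on_linear _ _ _ oO _ R (dot (- mu *: v)) u
    (@continuous_dot _ _ _) Cu).
- exact: has_trace_height Hp.
(* Likewise the trace of the gradient is inherited from that of [u]. *)
- by apply: (has_trace_eq gradq'); exact: has_traceZ Hu.
- exact: En.
- move=> X OX; rewrite /laplacian (div_eq_on oO gradq)//.
  by have [du _] := Cu X OX; rewrite divZ// divu// mulr0.
- by move=> x; exact: on_interface_height.
- by apply: (wall_conditionZ wok _ Hu gradq wc); rewrite oppr_eq0.
Qed.

Lemma elliptic_darcy (g mu rho : R) f phi :
  mu != 0 -> elliptic_solution s w eta f phi ->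
  darcy s w g mu rho eta (fun X => - mu^-1 *: grad phi X)
    (fun X => phi X + - (rho * g) * X.2).
Proof.
move=> mu0 [C2 Hphi Hg En harm dir wc].
have oO : open Om by exact: open_fluid.
have Cg : C1_on Om (grad phi) by exact: C1_on_grad.
split.
- pose L : {linear ambient R d -> ambient R d} := *:%R (- mu^-1).
  apply: (C1_on_linear oO (L := L)) Cg.
  by move=> X; apply: cvgZl_tmp; exact: cvg_id.
- exact: (C1_onD oO C2.1 (C1_on_height (- (rho * g)) oO)).
- exact: has_traceZ Hg.
- exact: has_trace_height Hphi.
(* Adding [rho * g * X.2] back to the pressure returns [phi], whose energy is finite. *)
- rewrite [X in grad X](_ : _ = phi)//.
  by apply/funext => X; rewrite mulNr subrK.
- move=> X OX; have [dphi _] := C2.1 X OX.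
  by rewrite grad_height// scalerA mulrN divff// scaleN1r addrA addNr add0r.
- by move=> X OX; have [dg _] := Cg X OX; rewrite divZ// [div _ _]harm// mulr0.
- by apply: (wall_conditionZ wok _ Hg _ wc) => //; rewrite oppr_eq0 invr_eq0.
Qed.

Lemma harmonic_extP f : DN_dom s w eta f ->
  elliptic_solution s w eta f (harmonic_ext s w eta f).
Proof. exact: (@xgetPex _ _ [set phi | elliptic_solution s w eta f phi]). Qed.

Lemma DN_darcy (g mu rho : R) (f : 'rV[R]_d -> R) :
  mu != 0 -> DN_dom s w eta f ->
  let phi := harmonic_ext s w eta f in
  let u := fun X => - mu^-1 *: grad phi X in
  let p := fun X => phi X + - (rho * g) * X.2 in
  [/\ darcy s w g mu rho eta u p,
      forall x, area eta x * dot (on_interface s w eta u x) (normal eta x) =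
        - mu^-1 * DN s w eta f x
    & forall x, on_interface s w eta p x = f x - rho * g * eta x].
Proof.
move=> mu0 /harmonic_extP ephi phi u p; split.
- exact: (elliptic_darcy g rho mu0 ephi).
- move=> x; rewrite (@on_interfaceZ (- mu^-1) (grad phi) u)//.
    by rewrite dotZl mulrCA.
  exact: ell_grad_trace ephi.
- move=> x; rewrite on_interface_height; last exact: ell_trace ephi.
  by rewrite (ell_dirichlet ephi) mulNr.
Qed.

Hypothesis uniq_ell : elliptic_unique s w eta.

(** By uniqueness the chosen extension agrees with [phi] on the fluid. As the fluid is open, the
    gradients agree there too, and hence so do their interface traces. *)
Lemma DN_elliptic f phi x : elliptic_solution s w eta f phi ->
  DN s w eta f x =
  area eta x * dot (on_interface s w eta (grad phi) x) (normal eta x).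
Proof.
move=> ephi; have oO : open Om by exact: open_fluid.
have eext := harmonic_extP (ex_intro _ phi ephi).
rewrite /DN /on_interface (@trace_eq _ _ _ _ _ (grad phi))// => X OX.
by apply: (grad_eq_on oO) OX => Y OY; exact: uniq_ell eext ephi _ OY.
Qed.

(** The reduced pressure is an admissible [phi] in [DN_elliptic], and its gradient is [- mu *: u];
    dividing by [- mu] gives the flux. *)
Lemma darcy_DN (g mu rho : R) u p x : mu != 0 ->
  darcy s w g mu rho eta u p ->
  area eta x * dot (on_interface s w eta u x) (normal eta x) =
  - mu^-1 * DN s w eta (fun x => on_interface s w eta p x + rho * g * eta x) x.
Proof.
move=> mu0 D; rewrite (DN_elliptic _ (darcy_elliptic mu0 D)).
rewrite (on_interfaceZ _ (darcy_u_trace D) (darcy_grad D)) dotZl.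
by rewrite mulrCA; congr (_ * _); rewrite mulrA mulrNN mulVf// mul1r.
Qed.

End Phase.
End Darcy.

(** * Equivalence of the Muskat problems with their interface equations *)

Theorem proposition1p1 (R : realType) (d : nat) (hd : (0 < d)%N)
    (T : set R) (hT : open T) (g sigma : R) (hsigma : 0 <= sigma)
    (eta : R -> 'rV[R]_d -> R) (heta : regular_interface T eta)
    (wm : wall R d) (hwm : forall t, T t -> wall_ok lower wm (eta t))
    (hum : forall t, T t -> elliptic_unique lower wm (eta t))
    (mum rhom : R) (hmum : 0 < mum) (hrhom : 0 < rhom) :
  (let f := fun t x => sigma * curvature (eta t) x + rhom * g * eta t x in
   (forall (u : R -> ambient R d -> ambient R d) (p : R -> ambient R d -> R),
      one_phase_muskat T wm g sigma mum rhom u p eta ->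
      evolution_eq T wm mum eta f) /\
   (evolution_eq T wm mum eta f ->
      exists (u : R -> ambient R d -> ambient R d) (p : R -> ambient R d -> R),
        one_phase_muskat T wm g sigma mum rhom u p eta)) /\
  (forall (wp : wall R d) (hwp : forall t, T t -> wall_ok upper wp (eta t))
     (hup : forall t, T t -> elliptic_unique upper wp (eta t))
     (mup rhop : R) (hmup : 0 < mup) (hrhop : 0 < rhop),
   (forall (up um : R -> ambient R d -> ambient R d) (pp pm : R -> ambient R d -> R),
      two_phase_muskat T wp wm g sigma mup mum rhop rhom up um pp pm eta ->
      let fp := fun t x =>
        on_interface upper wp (eta t) (pp t) x + rhop * g * eta t x in
      let fm := fun t x =>
        on_interface lower wm (eta t) (pm t) x + rhom * g * eta t x in
      evolution_eq T wm mum eta fm /\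
      interface_system T wp wm g sigma mup mum rhop rhom eta fp fm) /\
   (forall fp fm : R -> 'rV[R]_d -> R,
      evolution_eq T wm mum eta fm ->
      interface_system T wp wm g sigma mup mum rhop rhom eta fp fm ->
      exists (up um : R -> ambient R d -> ambient R d) (pp pm : R -> ambient R d -> R),
        two_phase_muskat T wp wm g sigma mup mum rhop rhom up um pp pm eta)).
Proof.
have mum0 : mum != 0 by rewrite gt_eqF.
have ceta t : T t -> continuous (eta t).
  move=> Tt x; apply: differentiable_continuous.
  by have [[/(_ x I)[]]] := heta _ Tt.
split.
  set f := fun t x => _; split=> [u p H t Tt|H].
    have [D kin jump] := H t Tt.
    (* The dynamic condition replaces the interface pressure by [sigma * curvature], so the
       Dirichlet datum of the reduced pressure is exactly [f t]. *)
    have fE : (fun x => on_interface lower wm (eta t) (p t) x +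
        rhom * g * eta t x) = f t.
      by apply/funext => x; rewrite jump.
    split.
      exists (fun X => p t X + rhom * g * X.2); rewrite -fE.
      exact: (darcy_elliptic (ceta t Tt) (hwm t Tt) mum0 D).
    move=> x; rewrite kin -fE.
    exact: (darcy_DN (ceta t Tt) (hwm t Tt) (hum t Tt) x mum0 D).
  exists (fun t X => - mum^-1 *: grad (harmonic_ext lower wm (eta t) (f t)) X).
  exists (fun t X => harmonic_ext lower wm (eta t) (f t) X + - (rhom * g) * X.2).
  move=> t Tt; have [fdom ev] := H t Tt.
  have [D flux pE] := DN_darcy (ceta t Tt) (hwm t Tt) g rhom mum0 fdom.
  split=> [|x|x]; [exact: D|by rewrite ev flux|].
  (* The hydrostatic part of [f] cancels, leaving [sigma * curvature]. *)
  by rewrite pE addrK.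
move=> wp hwp hup mup rhop hmup hrhop.
have mup0 : mup != 0 by rewrite gt_eqF.
split=> [up um pp pm H fp fm|fp fm ev sys].
  have Dm t (Tt : T t) := let: And5 _ D _ _ _ := H t Tt in D.
  have Dp t (Tt : T t) := let: And5 D _ _ _ _ := H t Tt in D.
  have fmdom t : T t -> DN_dom lower wm (eta t) (fm t).
    move=> Tt; exists (fun X => pm t X + rhom * g * X.2).
    exact: (darcy_elliptic (ceta t Tt) (hwm t Tt) mum0 (Dm t Tt)).
  have fpdom t : T t -> DN_dom upper wp (eta t) (fp t).
    move=> Tt; exists (fun X => pp t X + rhop * g * X.2).
    exact: (darcy_elliptic (ceta t Tt) (hwp t Tt) mup0 (Dp t Tt)).
  have fluxm t x (Tt : T t) := darcy_DN (ceta t Tt) (hwm t Tt) (hum t Tt)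
    x mum0 (Dm t Tt).
  have fluxp t x (Tt : T t) := darcy_DN (ceta t Tt) (hwp t Tt) (hup t Tt)
    x mup0 (Dp t Tt).
  split=> t Tt; have [_ _ cont kin jump] := H t Tt.
    by split=> [|x]; [exact: fmdom|rewrite kin fluxm].
  split=> [||x|x]; [exact: fpdom|exact: fmdom| |].
    by rewrite -jump /fm /fp !mulrDl; ring.
  (* Continuity of the normal velocity lets the same flux be computed from either phase; equating
     the two expressions gives the second line of the system. *)
  have := fluxm t x Tt; rewrite -cont (fluxp t x Tt) => /eqP.
  by rewrite !mulNr eqr_opp => /eqP ->; rewrite subrr.
exists (fun t X => - mup^-1 *: grad (harmonic_ext upper wp (eta t) (fp t)) X).
exists (fun t X => - mum^-1 *: grad (harmonic_ext lower wm (eta t) (fm t)) X).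
exists (fun t X => harmonic_ext upper wp (eta t) (fp t) X + - (rhop * g) * X.2).
exists (fun t X => harmonic_ext lower wm (eta t) (fm t) X + - (rhom * g) * X.2).
move=> t Tt; have [fpdom fmdom jump cont] := sys t Tt.
have [_ evt] := ev t Tt.
have [Dm fluxm pmE] := DN_darcy (ceta t Tt) (hwm t Tt) g rhom mum0 fmdom.
have [Dp fluxp ppE] := DN_darcy (ceta t Tt) (hwp t Tt) g rhop mup0 fpdom.
split; [exact: Dp|exact: Dm| | |] => x.
(* The fluxes are known only with the factor [area], which is positive and can be restored on both
   sides. *)
- apply: (mulfI (lt0r_neq0 (area_gt0 (eta t) x))).
  apply: (etrans (fluxp x)); apply: (etrans _ (esym (fluxm x))).
  by rewrite !mulNr (subr0_eq (cont x)).
- by rewrite evt fluxm.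
(* Adding and subtracting the buoyancy term makes the right-hand side of [jump] appear, so that
   [fm - fp] can replace it. *)
- rewrite pmE ppE -(addrK ((rhom - rhop) * g * eta t x) (sigma * _)) -jump.
  by ring.
Qed.
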